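(* Let $(M,\varphi,\xi,\eta,g)$ be an almost contact complex Riemannian manifold of dimension $2n+1$. The following conditions are equivalent: (a) $(M,\varphi,\xi,\eta,g)$ is Sasaki-like; (b) for all vector fields $x,y$ on $M$, $$(\nabla_x\varphi)y=-g(x,y)\xi-\eta(y)x+2\eta(x)\eta(y)\xi;$$ (c) the Nijenhuis tensor $N$ and the associated Nijenhuis tensor $\widehat N$ satisfy $$N=0,\qquad \widehat N=-4\left(\widetilde g-\eta\otimes\eta\right)\otimes\xi .$$
   Context: An almost contact complex Riemannian manifold $(M,\varphi,\xi,\eta,g)$ is a smooth $(2n+1)$-dimensional manifold $M$ with an endomorphism field $\varphi$ of $TM$, a vector field $\xi$, a 1-form $\eta$ and a pseudo-Riemannian metric $g$ of signature $(n+1,n)$ such that $\varphi\xi=0$, $\varphi^2=-\mathrm{Id}+\eta\otimes\xi$, $\eta\circ\varphi=0$, $\eta(\xi)=1$ and $g(\varphi x,\varphi y)=-g(x,y)+\eta(x)\eta(y)$ for all vector fields $x,y$. The associated metric is $\widetilde g(x,y)=g(x,\varphi y)+\eta(x)\eta(y)$. $\nabla$ is the Levi-Civita connection of $g$ and $F(x,y,z)=g((\nabla_x\varphi)y,z)$. Horizontal vector fields are the sections of $H=\ker\eta$. Sasaki-like means: for all horizontal $X,Y,Z$, $F(X,Y,Z)=F(\xi,Y,Z)=F(\xi,\xi,Z)=0$ and $F(X,Y,\xi)=-g(X,Y)$. Nijenhuis tensor: $N=[\varphi,\varphi]+\mathrm{d}\eta\otimes\xi$, where $[\varphi,\varphi](x,y)=[\varphi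 x,\varphi y]+\varphi^2[x,y]-\varphi[\varphi x,y]-\varphi[x,\varphi y]$ and $\mathrm{d}\eta(x,y)=x\eta(y)-y\eta(x)-\eta([x,y])$. Associated Nijenhuis tensor: with the symmetric brackets $\{x,y\}=\nabla_xy+\nabla_yx$, put $\{\varphi,\varphi\}(x,y)=\{\varphi x,\varphi y\}+\varphi^2\{x,y\}-\varphi\{\varphi x,y\}-\varphi\{x,\varphi y\}$ and $\widehat N=\{\varphi,\varphi\}+(\mathcal L_\xi g)\otimes\xi$, where $\mathcal L$ is the Lie derivative. *)

(* Defs.v *)
From HB Require Import structures.
From mathcomp Require Import all_boot all_order all_algebra.
From mathcomp Require Import all_classical all_reals all_analysis.
From mathcomp Require Import sesquilinear ring.

Set Implicit Arguments.
Unset Strict Implicit.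
Unset Printing Implicit Defensive.

Import Order.TTheory GRing.Theory Num.Theory.
Import numFieldNormedType.Exports.

Local Open Scope classical_set_scope.
Local Open Scope ring_scope.

(* Meaningful for U open: the values of ['D_v f] on U then depend only on the
   restriction of f to U. *)
Fixpoint Ck (R : realType) (V W : normedModType R) (k : nat) (U : set V)
    (f : V -> W) : Prop :=
  if k is k'.+1 then
    (forall x, U x -> differentiable f x) /\
    (forall v, Ck k' U (fun x => 'D_v f x))
  else forall x, U x -> {for x, continuous f}.

Definition Coo (R : realType) (V W : normedModType R) (U : set V)
    (f : V -> W) : Prop := forall k, Ck k U f.

Section CkTheory.
Context {R : realType} {V : normedModType R}.
Implicit Types (U : set V).

Lemma differentiable_near_eq (W : normedModType R) (f g : V -> W) (x : V) :
  (\forall y \near x, f y = g y) -> differentiable f x -> differentiable g x.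
Proof.
move=> fg /diff_locallyP [dfc dfx]; apply/diff_locallyP.
have gx : g \o shift x = cst (g x) + 'd f x +o_ 0 id.
  apply/eqaddoP => _/posnumP[e].
  have /eqaddoP/(_ _ [gt0 of e%:num]) := dfx.
  move/nbhs0P: (fg) => fg0; apply: filterS2 fg0 => h /=.
  by rewrite !fctE /= -(nbhs_singleton fg) [h + x]addrC => <-.
by rewrite (diff_unique dfc gx).
Qed.

Lemma derive_near_eq (W : normedModType R) (f g : V -> W) (x v : V) :
  (\forall y \near x, f y = g y) -> 'D_v f x = 'D_v g x.
Proof.
move=> fg; have fgx := nbhs_singleton fg.
have near0 : \forall h \near (0 : R)^', f (h *: v + x) = g (h *: v + x).
  apply: cvg_within; apply: (@near0Z _ _ v (fun z => f (z + x) = g (z + x))).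
  by move/nbhs0P: fg; apply: filterS => z; rewrite [z + x]addrC.
rewrite /derive; congr lim; apply/seteqP; split; apply: near_eq_cvg;
  by apply: filterS near0 => h /= ->; rewrite fgx.
Qed.

Lemma eq_Ck (W : normedModType R) (k : nat) (U : set V) (f g : V -> W) :
  open U -> (forall x, U x -> f x = g x) -> Ck k U f -> Ck k U g.
Proof.
move=> oU; have nearU x : U x -> forall h1 h2 : V -> W,
    (forall x, U x -> h1 x = h2 x) -> \forall y \near x, h1 y = h2 y.
  move=> Ux h1 h2 h12; have : \forall y \near x, U y by exact: open_nbhs_nbhs.
  by apply: filterS => y /h12.
elim: k f g => [|k IHk] f g fg /=.
  move=> cf x Ux; have cfx := cf x Ux.
  rewrite /prop_for /continuous_at -(fg _ Ux).
  by apply: cvg_trans cfx; apply: near_eq_cvg; apply: nearU => // y /fg.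
move=> [df Df]; split=> [x Ux|v].
  by apply: differentiable_near_eq (df x Ux); apply: nearU.
apply: IHk (Df v) => x Ux; apply: derive_near_eq; exact: nearU.
Qed.

Lemma CkW (W : normedModType R) (k : nat) (U : set V) (f : V -> W) :
  Ck k.+1 U f -> Ck k U f.
Proof.
elim: k f => [|k IHk] f; first by case=> df _ x /df/differentiable_continuous.
by move=> [df Df]; split=> // v; apply: IHk; exact: Df.
Qed.

Lemma Ck_cst (W : normedModType R) (k : nat) (U : set V) (a : W) :
  Ck k U (cst a).
Proof.
elim: k a => [|k IHk] a /=; first by move=> x _; apply: cst_continuous.
split=> [x _|v]; first exact: differentiable_cst.
by rewrite (_ : (fun x => _) = cst 0) //; apply/funext => x; rewrite derive_cst.
Qed.

Lemma CkD (W : normedModType R) (k : nat) (U : set V) (f g : V -> W) :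
  open U -> Ck k U f -> Ck k U g -> Ck k U (f + g).
Proof.
move=> oU; elim: k f g => [|k IHk] f g /=.
  by move=> cf cg x Ux; apply: continuousD; [apply: cf | apply: cg].
move=> [df Df] [dg Dg]; split=> [x Ux|v].
  by apply: differentiableD; [apply: df | apply: dg].
apply: eq_Ck (IHk _ _ (Df v) (Dg v)) => // x Ux /=.
rewrite deriveD //; apply: diff_derivable; [exact: df|exact: dg].
Qed.

Lemma CkM (k : nat) (U : set V) (f g : V -> R) :
  open U -> Ck k U f -> Ck k U g -> Ck k U (f * g).
Proof.
move=> oU; elim: k f g => [|k IHk] f g.
  by move=> cf cg x Ux; apply: continuousM; [apply: cf | apply: cg].
move=> Cf Cg; have [[df Df] [dg Dg]] := (Cf, Cg); split=> [x Ux|v].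
  by apply: differentiableM; [apply: df | apply: dg].
apply: (@eq_Ck _ k U (f * (fun x => 'D_v g x) + g * (fun x => 'D_v f x))) => //.
  move=> x Ux /=; rewrite deriveM; first by [].
    by apply: diff_derivable; exact: df.
  by apply: diff_derivable; exact: dg.
apply: CkD => //; apply: IHk; [exact: CkW|exact: Dg|exact: CkW|exact: Df].
Qed.

End CkTheory.

Record chart (R : realType) (M : topologicalType) (m : nat) := Chart {
  chart_dom : set M;
  chart_map :> M -> 'rV[R]_m;
  chart_inv : 'rV[R]_m -> M;
  chart_dom_open : open chart_dom;
  chart_img_open : open (chart_map @` chart_dom);
  chartK : forall p, chart_dom p -> chart_inv (chart_map p) = p;
  chart_continuous : forall p, chart_dom p -> {for p, continuous chart_map};
  chart_inv_continuous : forall x, (chart_map @` chart_dom) x ->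
    {for x, continuous chart_inv}
}.

Arguments chart_dom_open {R M m} c.
Arguments chart_img_open {R M m} c.

Record manifold (R : realType) (m : nat) := Manifold {
  carrier :> topologicalType;
  carrier_hausdorff : hausdorff_space carrier;
  carrier_second_countable : @second_countable carrier;
  atlas : set (chart R carrier m);
  atlas_cover : forall p, exists2 c, atlas c & chart_dom c p;
  atlas_compat : forall c d, atlas c -> atlas d ->
    Coo (c @` (chart_dom c `&` chart_dom d)) (d \o chart_inv c)
}.

Definition smooth (R : realType) (m : nat) (M : manifold R m) (f : M -> R) :=
  forall c, atlas c -> Coo (c @` chart_dom c) (f \o chart_inv c).

Definition smooth_pred (R : realType) (m : nat) (M : manifold R m) :
  {pred M -> R} := fun f => `[< smooth f >].

(* No [nzRingType] structure: M may be empty. *)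
Record smoothfun (R : realType) (m : nat) (M : manifold R m) := SmoothFun {
  smoothfun_val :> M -> R;
  _ : smoothfun_val \in @smooth_pred R m M
}.

Section SmoothFun.
Context {R : realType} {m : nat} {M : manifold R m}.

HB.instance Definition _ := [isSub for @smoothfun_val R m M].
HB.instance Definition _ := [Choice of smoothfun M by <:].

Lemma smoothE (f : M -> R) : (f \in @smooth_pred R m M) <-> smooth f.
Proof. by split=> [/asboolP|?]; last exact/asboolP. Qed.

Lemma smooth_cst (a : R) : smooth (cst a : M -> R).
Proof. by move=> c _ k; exact: Ck_cst. Qed.

Lemma smoothD (f g : M -> R) : smooth f -> smooth g -> smooth (f + g).
Proof.
move=> sf sg c ac k.
exact: (CkD (chart_img_open c) (sf c ac k) (sg c ac k)).
Qed.

Lemma smoothM (f g : M -> R) : smooth f -> smooth g -> smooth (f * g).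
Proof.
move=> sf sg c ac k.
exact: (CkM (chart_img_open c) (sf c ac k) (sg c ac k)).
Qed.

Lemma smoothZ (a : R) (f : M -> R) : smooth f -> smooth (a *: f).
Proof. exact: (smoothM (smooth_cst a)). Qed.

Lemma smoothN (f : M -> R) : smooth f -> smooth (- f).
Proof. by rewrite -scaleN1r; exact: smoothZ. Qed.

Lemma smooth_subring_closed : subring_closed (@smooth_pred R m M).
Proof.
split=> [|f g /smoothE sf /smoothE sg|f g /smoothE sf /smoothE sg].
- by apply/smoothE; exact: smooth_cst.
- by apply/smoothE; apply: smoothD => //; exact: smoothN.
- by apply/smoothE; exact: smoothM.
Qed.

Lemma smooth_scaler_closed : GRing.scaler_closed (@smooth_pred R m M).
Proof. by move=> a f /smoothE sf; apply/smoothE; exact: smoothZ. Qed.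

HB.instance Definition _ := GRing.isSubringClosed.Build (M -> R)
  (@smooth_pred R m M) smooth_subring_closed.
HB.instance Definition _ := GRing.isScaleClosed.Build R (M -> R)
  (@smooth_pred R m M) smooth_scaler_closed.
HB.instance Definition _ := GRing.SubChoice_isSubComPzRing.Build (M -> R)
  (@smooth_pred R m M) (smoothfun M) smooth_subring_closed.
HB.instance Definition _ :=
  [SubZmodule_isSubLmodule of smoothfun M by <:].

Definition smoothfun_of (f : M -> R) (sf : smooth f) : smoothfun M :=
  SmoothFun (introT (asboolP (smooth f)) sf).

Lemma smoothfunP (f : smoothfun M) : smooth f.
Proof. by apply/smoothE; case: f. Qed.

Lemma smoothfun_eq (f g : smoothfun M) : (forall p, f p = g p) -> f = g.
Proof. by move=> fg; apply/val_inj/funext. Qed.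

End SmoothFun.

Section Tangent.
Context {R : realType} {m : nat} {M : manifold R m}.

(* T_pM is the space of point derivations of C^oo(M) at p; a field of tangent
   vectors, covectors or tensors is smooth when it sends smooth functions and
   smooth vector fields to smooth objects. *)
Definition derivation_at (p : M) (v : smoothfun M -> R) : Prop :=
  (forall (a : R) f g, v (a *: f + g) = a * v f + v g) /\
  (forall f g, v (f * g) = f p * v g + g p * v f).

Definition derivation_at_pred (p : M) : {pred smoothfun M -> R} :=
  fun v => `[< derivation_at p v >].

Record tangent (p : M) := Tangent {
  tangent_val :> smoothfun M -> R;
  _ : tangent_val \in derivation_at_pred p
}.

HB.instance Definition _ p := [isSub for @tangent_val p].
HB.instance Definition _ p := [Choice of tangent p by <:].

Lemma derivation_submod_closed (p : M) :
  GRing.submod_closed (derivation_at_pred p).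
Proof.
split=> [|a v w /asboolP[vl vM] /asboolP[wl wM]]; apply/asboolP; split.
- by move=> a f g; rewrite /= mulr0 addr0.
- by move=> f g; rewrite /= !mulr0 addr0.
- move=> b f g; rewrite !fctE /= vl wl /GRing.scale /=; ring.
- move=> f g; rewrite !fctE /= vM wM /GRing.scale /=; ring.
Qed.

HB.instance Definition _ p := GRing.isSubmodClosed.Build R (smoothfun M -> R)
  (derivation_at_pred p) (derivation_submod_closed p).
HB.instance Definition _ p := [SubChoice_isSubLmodule of tangent p by <:].

Definition tangent_of (p : M) (v : smoothfun M -> R) (dv : derivation_at p v) :
  tangent p := Tangent (introT (asboolP (derivation_at p v)) dv).

Lemma tangentP (p : M) (v : tangent p) : derivation_at p v.
Proof. by case: v => v /= /asboolP. Qed.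

Lemma tangent_eq (p : M) (v w : tangent p) : (forall f, v f = w f) -> v = w.
Proof. by move=> vw; apply/val_inj/funext. Qed.

End Tangent.

Record vfield (R : realType) (m : nat) (M : manifold R m) := VField {
  vfield_val :> forall p : M, tangent p;
  vfield_smooth : forall f : smoothfun M, smooth (fun p => vfield_val p f)
}.

Section VectorField.
Context {R : realType} {m : nat} {M : manifold R m}.
Implicit Types (X Y Z : vfield M) (f g : smoothfun M).

HB.instance Definition _ := gen_eqMixin (vfield M).
HB.instance Definition _ := gen_choiceMixin (vfield M).

Lemma vfield_eq X Y : (forall p, X p = Y p) -> X = Y.
Proof.
case: X Y => [X sX] [Y sY] /= XY.
have {}XY : X = Y by exact: functional_extensionality_dep.
by move: sX sY; rewrite XY => sX sY; congr VField; exact: Prop_irrelevance.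
Qed.

Definition vf_app X f : smoothfun M := smoothfun_of (vfield_smooth X f).

Definition vf_zero : vfield M :=
  @VField R m M (fun p => 0) (fun f => smooth_cst 0).

Definition vf_add X Y : vfield M :=
  @VField R m M (fun p => X p + Y p)
    (fun f => smoothD (vfield_smooth X f) (vfield_smooth Y f)).

Definition vf_opp X : vfield M :=
  @VField R m M (fun p => - X p) (fun f => smoothN (vfield_smooth X f)).

Definition vf_scale f X : vfield M :=
  @VField R m M (fun p => f p *: X p)
    (fun h => smoothM (smoothfunP f) (vfield_smooth X h)).

Fact vf_addA : associative vf_add.
Proof. by move=> X Y Z; apply: vfield_eq => p /=; rewrite addrA. Qed.

Fact vf_addC : commutative vf_add.
Proof. by move=> X Y; apply: vfield_eq => p /=; rewrite addrC. Qed.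

Fact vf_add0 : left_id vf_zero vf_add.
Proof. by move=> X; apply: vfield_eq => p /=; rewrite add0r. Qed.

Fact vf_addN : left_inverse vf_zero vf_opp vf_add.
Proof. by move=> X; apply: vfield_eq => p /=; rewrite addNr. Qed.

HB.instance Definition _ :=
  GRing.isZmodule.Build (vfield M) vf_addA vf_addC vf_add0 vf_addN.

Fact vf_scaleA f g X : vf_scale f (vf_scale g X) = vf_scale (f * g) X.
Proof. by apply: vfield_eq => p /=; rewrite scalerA. Qed.

Fact vf_scale1 : left_id 1 vf_scale.
Proof. by move=> X; apply: vfield_eq => p /=; rewrite scale1r. Qed.

Fact vf_scaleDr : right_distributive vf_scale +%R.
Proof. by move=> f X Y; apply: vfield_eq => p /=; rewrite scalerDr. Qed.

Fact vf_scaleDl X : {morph vf_scale^~ X : f g / f + g}.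
Proof. by move=> f g; apply: vfield_eq => p /=; rewrite scalerDl. Qed.

HB.instance Definition _ := GRing.Zmodule_isLmodule.Build (smoothfun M)
  (vfield M) vf_scaleA vf_scale1 vf_scaleDr vf_scaleDl.

Lemma vf_appD X f g : vf_app X (f + g) = vf_app X f + vf_app X g.
Proof.
apply: smoothfun_eq => p /=.
by have [+ _] := tangentP (X p) => /(_ 1 f g); rewrite scale1r mul1r.
Qed.

Lemma vf_appZ X (a : R) f : vf_app X (a *: f) = a *: vf_app X f.
Proof.
apply: smoothfun_eq => p /=; have [Xl _] := tangentP (X p).
have X0 : X p 0 = 0.
  have := Xl 1 0 0; rewrite scale1r mul1r addr0 => X00.
  by apply: (addrI (X p 0)); rewrite -X00 addr0.
by have := Xl a f 0; rewrite X0 !addr0.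
Qed.

Lemma vf_appM X f g : vf_app X (f * g) = f * vf_app X g + g * vf_app X f.
Proof. by apply: smoothfun_eq => p /=; have [_ ->] := tangentP (X p). Qed.

Fact lie_derivation X Y (p : M) :
  derivation_at p (fun f => X p (vf_app Y f) - Y p (vf_app X f)).
Proof.
have [Xl XM] := tangentP (X p); have [Yl YM] := tangentP (Y p).
split=> [a f g|f g].
  by rewrite !vf_appD !vf_appZ Xl Yl; ring.
have XD u v : X p (u + v) = X p u + X p v.
  by rewrite -{1}[u]scale1r Xl mul1r.
have YD u v : Y p (u + v) = Y p u + Y p v.
  by rewrite -{1}[u]scale1r Yl mul1r.
by rewrite !vf_appM XD YD !XM !YM /=; ring.
Qed.

Fact lie_smooth X Y f :
  smooth (fun p => tangent_of (lie_derivation X Y p) f).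
Proof.
apply: smoothD; first exact: (vfield_smooth X (vf_app Y f)).
exact: smoothN (vfield_smooth Y (vf_app X f)).
Qed.

Definition lie X Y : vfield M := VField (lie_smooth X Y).

End VectorField.

Record endofield (R : realType) (m : nat) (M : manifold R m) := EndoField {
  endofield_val : forall p : M, {linear tangent p -> tangent p};
  endofield_smooth : forall (X : vfield M) (f : smoothfun M),
    smooth (fun p => endofield_val p (X p) f)
}.

Record oneform (R : realType) (m : nat) (M : manifold R m) := OneForm {
  oneform_val : forall p : M, {scalar tangent p};
  oneform_smooth : forall X : vfield M, smooth (fun p => oneform_val p (X p))
}.

(* Signature (number of +1's, number of -1's); it makes b nondegenerate and V of
   dimension r + s. *)
Definition has_signature (R : realType) (V : lmodType R) (b : V -> V -> R)
    (r s : nat) : Prop :=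
  exists e : 'I_(r + s) -> V,
    (forall v, exists! a : 'rV[R]_(r + s), v = \sum_i a 0 i *: e i) /\
    (forall i j, b (e i) (e j) =
       if i == j then (if (i < r)%N then 1 else -1) else 0).

Record pseudo_metric (R : realType) (m : nat) (M : manifold R m) (r s : nat) :=
  PseudoMetric {
    metric_val : forall p : M, {biscalar (tangent p)};
    metric_sym : forall p v w, metric_val p v w = metric_val p w v;
    metric_signature : forall p, has_signature (metric_val p) r s;
    metric_smooth : forall X Y : vfield M,
      smooth (fun p => metric_val p (X p) (Y p))
  }.

Section Fields.
Context {R : realType} {m : nat} {M : manifold R m}.

Definition endo_app (phi : endofield M) (X : vfield M) : vfield M :=
  VField (endofield_smooth phi X).

Definition form_app (eta : oneform M) (X : vfield M) : smoothfun M :=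
  smoothfun_of (oneform_smooth eta X).

Definition metric_app (r s : nat) (g : pseudo_metric M r s) (X Y : vfield M) :
  smoothfun M := smoothfun_of (metric_smooth g X Y).

Coercion endo_app : endofield >-> Funclass.
Coercion form_app : oneform >-> Funclass.
Coercion metric_app : pseudo_metric >-> Funclass.

Implicit Types (X Y Z : vfield M) (f : smoothfun M).

Definition d_form (eta : oneform M) X Y : smoothfun M :=
  vf_app X (eta Y) - vf_app Y (eta X) - eta (lie X Y).

Definition lie_metric (r s : nat) (g : pseudo_metric M r s) Z X Y :
    smoothfun M :=
  vf_app Z (g X Y) - g (lie Z X) Y - g X (lie Z Y).

(* R-linearity in the second argument follows from additivity and the Leibniz
   rule applied to constant functions. *)
Definition affine_connection (nabla : vfield M -> vfield M -> vfield M) : Prop :=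
  [/\ forall f X X' Y, nabla (f *: X + X') Y = f *: nabla X Y + nabla X' Y,
      forall X Y Y', nabla X (Y + Y') = nabla X Y + nabla X Y' &
      forall f X Y, nabla X (f *: Y) = vf_app X f *: Y + f *: nabla X Y].

Definition levi_civita (r s : nat) (g : pseudo_metric M r s)
    (nabla : vfield M -> vfield M -> vfield M) : Prop :=
  [/\ affine_connection nabla,
      forall X Y, nabla X Y - nabla Y X = lie X Y &
      forall X Y Z, vf_app X (g Y Z) = g (nabla X Y) Z + g Y (nabla X Z)].

End Fields.

Record accR_structure (R : realType) (n : nat) (M : manifold R (2 * n + 1)%N) :=
  AccRStructure {
    acc_phi : endofield M;
    acc_xi : vfield M;
    acc_eta : oneform M;
    acc_g : pseudo_metric M n.+1 n;
    acc_phi_xi : acc_phi acc_xi = 0;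
    acc_phi2 : forall x, acc_phi (acc_phi x) = - x + acc_eta x *: acc_xi;
    acc_eta_phi : forall x, acc_eta (acc_phi x) = 0;
    acc_eta_xi : acc_eta acc_xi = 1;
    acc_compat : forall x y, acc_g (acc_phi x) (acc_phi y) =
      - acc_g x y + acc_eta x * acc_eta y
  }.

Section AccR.
Context {R : realType} {n : nat} {M : manifold R (2 * n + 1)%N}.
Variables (S : accR_structure M) (nabla : vfield M -> vfield M -> vfield M).
Local Notation phi := (acc_phi S).
Local Notation xi := (acc_xi S).
Local Notation eta := (acc_eta S).
Local Notation g := (acc_g S).
Implicit Types (x y z : vfield M).

Definition assoc_metric x y : smoothfun M := g x (phi y) + eta x * eta y.

Definition nabla_phi x y : vfield M := nabla x (phi y) - phi (nabla x y).

Definition F_tensor x y z : smoothfun M := g (nabla_phi x y) z.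

Definition horizontal x : Prop := eta x = 0.

Definition sasaki_like : Prop :=
  forall X Y Z, horizontal X -> horizontal Y -> horizontal Z ->
  [/\ F_tensor X Y Z = 0, F_tensor xi Y Z = 0, F_tensor xi xi Z = 0 &
      F_tensor X Y xi = - g X Y].

Definition nijenhuis_phi x y : vfield M :=
  lie (phi x) (phi y) + phi (phi (lie x y))
  - phi (lie (phi x) y) - phi (lie x (phi y)).

Definition nijenhuis x y : vfield M :=
  nijenhuis_phi x y + d_form eta x y *: xi.

Definition sym_bracket x y : vfield M := nabla x y + nabla y x.

Definition assoc_nijenhuis_phi x y : vfield M :=
  sym_bracket (phi x) (phi y) + phi (phi (sym_bracket x y))
  - phi (sym_bracket (phi x) y) - phi (sym_bracket x (phi y)).

Definition assoc_nijenhuis x y : vfield M :=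
  assoc_nijenhuis_phi x y + lie_metric g xi x y *: xi.

End AccR.

(* Main.v *)
(* Nondegeneracy of g on vector fields reduces everything to identities between
   functions.  It needs enough global vector fields: in a chart around p, the
   coordinate derivations multiplied by a bump function extend by zero to M,
   and they are linearly independent at p (test them on the cut-off
   coordinates), hence span T_pM because the signature fixes its dimension.

   Write A_x = nabla_x phi, F(x,y,z) = g(A_x y, z), k(x,y) = g(nabla_x xi, y)
   and B(x,y) = A_{phi x} y - phi A_x y + k(x,y) xi.  Then
   N(x,y) = B(x,y) - B(y,x) and \hat N(x,y) = B(x,y) + B(y,x), so (c) says
   B(x,y) = -2 g(x, phi y) xi, that is
     F(phi x,y,z) = F(x,y,phi z) - (k(x,y) + 2 g(x,phi y)) eta(z).
   The left side is symmetric in y and z; comparing the two right sides by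
   A_x phi y + phi A_x y = k(x,y) xi + eta(y) nabla_x xi determines
   F(x,y,phi z), and z = xi then gives k(x,y) = - g(x, phi y), hence (b).
   The equivalence of (a) and (b) is the splitting of each argument of F into
   its horizontal part and its xi-component. *)

Require Import Defs.
From HB Require Import structures.
From mathcomp Require Import all_boot all_order all_algebra.
From mathcomp Require Import all_classical all_reals all_analysis.
From mathcomp Require Import sesquilinear ring lra.

Set Implicit Arguments.
Unset Strict Implicit.
Unset Printing Implicit Defensive.

Import Order.TTheory GRing.Theory Num.Theory.
Import numFieldNormedType.Exports.

Local Open Scope classical_set_scope.
Local Open Scope ring_scope.

(** * Calculus of [Ck] maps: locality and composition *)

Section CkCalculus.
Context {R : realType}.

(** Every clause of [Ck] is a condition at single points on globally defined derivatives, so the set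
    may vary with the point. *)
Lemma Ck_local (V W : normedModType R) (k : nat) (U : set V) (f : V -> W) :
  (forall x, U x -> exists2 U', U' x & Ck k U' f) -> Ck k U f.
Proof.
elim: k f => [|k IHk] f fU /=.
  by move=> x /fU[U' U'x cf]; exact: cf.
split=> [x /fU[U' U'x [df _]]|v]; first exact: df.
by apply: IHk => x /fU[U' U'x [_ Df]]; exists U' => //; exact: Df.
Qed.

Lemma Ck_sub (V W : normedModType R) (k : nat) (U U' : set V) (f : V -> W) :
  U `<=` U' -> Ck k U' f -> Ck k U f.
Proof. by move=> UU' fU'; apply: Ck_local => x /UU' U'x; exists U'. Qed.

Lemma derive_comp (V V' W : normedModType R) (f : V' -> W) (h : V -> V') x v :
  differentiable h x -> differentiable f (h x) ->
  'D_v (f \o h) x = 'd f (h x) ('D_v h x).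
Proof.
move=> dh df; rewrite !deriveE //; first by rewrite diff_comp.
exact: differentiable_comp.
Qed.

Lemma Ck_linear (V W W' : normedModType R) (L : {linear W -> W'}) (k : nat)
    (U : set V) (f : V -> W) :
  continuous L -> open U -> Ck k U f -> Ck k U (L \o f).
Proof.
move=> cL oU; elim: k f => [|k IHk] f /=.
  by move=> cf x Ux; apply: continuous_comp; [exact: cf|exact: cL].
have dL x : differentiable L x by exact: linear_differentiable.
move=> [df Df]; split=> [x Ux|v]; first exact: differentiable_comp (df x Ux) _.
apply: (eq_Ck oU _ (IHk _ (Df v))) => x Ux.
by rewrite derive_comp ?diff_lin //; exact: df.
Qed.

Lemma Ck_sum (V : normedModType R) (k n : nat) (U : set V)
    (f : 'I_n -> V -> R) :
  open U -> (forall i, Ck k U (f i)) -> Ck k U (fun x => \sum_i f i x).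
Proof.
move=> oU Cf; rewrite -(@fct_sumE _ _ _ _ xpredT f).
by elim/big_ind: _ => [|g h|i _]; [exact: Ck_cst|exact: CkD|exact: Cf].
Qed.

(** Induction on [k]: in the basis [e] with coordinates [l], the chain rule writes a derivative of
    [f \o h] as a sum of products of [l i ('D_v h x)] and ['D_(e i) f (h x)], each of the order
    required. *)
Lemma Ck_comp (V V' : normedModType R) (n : nat) (e : 'I_n -> V')
    (l : 'I_n -> {linear V' -> R^o}) (k : nat) (U : set V) (U' : set V')
    (f : V' -> R) (h : V -> V') :
  (forall v, v = \sum_i l i v *: e i) -> (forall i, continuous (l i)) ->
  open U -> (forall x, U x -> U' (h x)) -> Ck k U h -> Ck k U' f ->
  Ck k U (f \o h).
Proof.
move=> le cl oU hU; elim: k f h hU => [|k IHk] f h hU.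
  by move=> ch cf x Ux; apply: continuous_comp; [exact: ch|exact/cf/hU].
move=> Ch Cf; have [[dh Dh] [df Df]] := (Ch, Cf); split=> [x Ux|v].
  by apply: differentiable_comp; [exact: dh|exact: (df _ (hU _ Ux))].
pose F x := \sum_i (l i ('D_v h x) * 'D_(e i) f (h x) : R).
apply: (@eq_Ck _ _ _ _ _ F) => // [x Ux|].
  rewrite derive_comp; [|exact: dh|exact: (df _ (hU _ Ux))].
  rewrite [in RHS](le ('D_v h x)) linear_sum; apply: eq_bigr => i _.
  by rewrite linearZ -deriveE //; exact: (df _ (hU _ Ux)).
apply: Ck_sum => // i; apply: CkM => //.
  by apply: (@Ck_linear _ _ _ (l i)) => //; exact: (Dh v).
by apply: (IHk ('D_(e i) f)); [exact: hU|exact: CkW|exact: (Df (e i))].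
Qed.

Lemma Ck_comp_R (V : normedModType R) (k : nat) (U : set V) (U' : set R)
    (f : R -> R) (h : V -> R) :
  open U -> (forall x, U x -> U' (h x)) -> Ck k U h -> Ck k U' f ->
  Ck k U (f \o h).
Proof.
apply: (@Ck_comp V R^o 1%N (fun=> 1) (fun=> idfun : {linear R^o -> R^o}))
  => [v|i x]; last exact: cvg_id.
by rewrite big_ord1 /= /GRing.scale /= mulr1.
Qed.

Definition row_coord (m : nat) (j : 'I_m) (x : 'rV[R]_m) : R^o := x 0 j.

Fact row_coord_is_linear m (j : 'I_m) : linear (row_coord j).
Proof. by move=> a x y; rewrite /row_coord !mxE. Qed.

HB.instance Definition _ m (j : 'I_m) :=
  GRing.isLinear.Build R 'rV[R]_m R^o _ (row_coord j) (row_coord_is_linear j).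

Lemma Ck_comp_rV (V : normedModType R) (m k : nat) (U : set V)
    (U' : set 'rV[R]_m) (f : 'rV[R]_m -> R) (h : V -> 'rV[R]_m) :
  open U -> (forall x, U x -> U' (h x)) -> Ck k U h -> Ck k U' f ->
  Ck k U (f \o h).
Proof.
apply: (@Ck_comp _ _ m (fun j => 'e_j) (@row_coord m)) => [v|i].
  exact: row_sum_delta.
exact: coord_continuous.
Qed.

Lemma Ck_row_coord (m k : nat) (U : set 'rV[R]_m) (j : 'I_m) :
  Ck k U (@row_coord m j).
Proof.
have cj : continuous (@row_coord m j) by exact: coord_continuous.
have dj x : differentiable (@row_coord m j) x by exact: linear_differentiable.
case: k => [|k] /=; first by move=> x _; exact: cj.
split=> [x _|v]; first exact: dj.
rewrite (_ : (fun x => _) = cst (row_coord j v)); first exact: Ck_cst.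
by apply/funext => x; rewrite deriveE // diff_lin.
Qed.

End CkCalculus.

(** * A smooth function on the line that is flat at 0 *)

Section FlatFunction.
Context {R : realType}.

(** The bump function is built from [k = 0]; higher [k] come from differentiation. *)
Definition flat (k : nat) (t : R) : R :=
  if 0 < t then t ^- k * expR (- t^-1) else 0.

Lemma flat_gt0 k t : 0 < t -> 0 < flat k t.
Proof.
by move=> t0; rewrite /flat t0 mulr_gt0 ?expR_gt0// invr_gt0 exprn_gt0.
Qed.

Lemma flat_le0 k t : t <= 0 -> flat k t = 0.
Proof. by rewrite /flat leNgt => /negbTE ->. Qed.

(** For t > 0 this is e^u >= u^(k+1)/(k+1)! at u = 1/t. It gives the limit 0 at the origin. *)
Lemma flat_le k t : `|flat k t| <= k.+1`!%:R * `|t|.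
Proof.
have [t0|t0] := leP t 0; first by rewrite flat_le0 // normr0 mulr_ge0.
rewrite (gtr0_norm (flat_gt0 _ t0)) (gtr0_norm t0) /flat t0 expRN.
have u0 : 0 < t^-1 by rewrite invr_gt0.
have F0 : 0 < k.+1`!%:R :> R by rewrite ltr0n fact_gt0.
have := expR_ge1Dxn k (ltW u0) => E.
have {}E : t^-1 ^+ k.+1 <= k.+1`!%:R * expR t^-1.
  rewrite mulrC -ler_pdivrMr //; apply: le_trans E; lra.
rewrite -exprVn ler_pdivrMr ?expR_gt0 // mulrAC -ler_pdivrMr //.
by rewrite mulrC -exprS.
Qed.

(* The family is stable under derivation, so smoothness follows by induction on
   the order for all k at once. *)
Lemma is_derive_flat k (t : R) :
  is_derive t 1 (flat k) (- k%:R * flat k.+1 t + flat k.+2 t).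
Proof.
have [t0|t0|->] := ltgtP t 0.
- rewrite !flat_le0 ?ltW // mulr0 addr0.
  apply: (@near_eq_is_derive _ _ _ (cst 0)).
  near=> s; rewrite flat_le0 //; near: s; exact: lt_le_nbhsl.
- have dt := is_derive_id t 1.
  have dV : is_derive t 1 (fun s : R => s^-1) (- t ^- 2).
    apply: DeriveDef; first by apply: derivableV; rewrite ?gt_eqF.
    by rewrite deriveV ?gt_eqF // derive_id /GRing.scale /= mulr1.
  have dN : is_derive t 1 (fun s : R => - s^-1) (t ^- 2).
    by have := is_deriveN dV; rewrite opprK.
  have dE : is_derive t 1 (fun s : R => expR (- s^-1)) (expR (- t^-1) * t ^- 2).
    exact: (@is_derive1_comp _ expR).
  have tk0 : t ^+ k != 0 by rewrite expf_neq0 // gt_eqF.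
  have dP : is_derive t 1 (fun s : R => s ^- k) (- k%:R * t ^- k.+1).
    have dX : derivable (GRing.exp (R:=R)^~ k) t 1 by exact: exprn_derivable.
    apply: DeriveDef; first exact: derivableV.
    rewrite deriveV // exp_derive /GRing.scale /=.
    case: k tk0 {dX} => [|j] tk0 /=; first by rewrite !mul0r mulr0 oppr0 mul0r.
    have tj0 : t ^+ j != 0 by rewrite expf_neq0 // gt_eqF.
    rewrite !exprS; field; rewrite tj0 gt_eqF //.
  have dD := is_deriveM dP dE.
  have -> : - k%:R * flat k.+1 t + flat k.+2 t =
      t ^- k *: (expR (- t^-1) * t ^- 2) +
      expR (- t^-1) *: (- k%:R * t ^- k.+1).
    rewrite /flat t0 /GRing.scale /= !exprS; field; rewrite tk0 gt_eqF //.
  apply: near_eq_is_derive dD.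
    near=> s; rewrite /flat ifT //; near: s; exact: lt_nbhsr.
rewrite !flat_le0 // mulr0 addr0.
(* The difference quotient at 0 is [flat k.+1] itself, which tends to 0 by [flat_le]. *)
have lim0 : h^-1 *: (flat k (h *: 1 + 0) - flat k 0) @[h --> 0^'] --> (0 : R).
  have -> : (fun h : R => h^-1 *: (flat k (h *: 1 + 0) - flat k 0)) = flat k.+1.
    apply/funext => h; rewrite addr0 (flat_le0 _ (lexx 0)) subr0.
    rewrite /GRing.scale /= mulr1 /flat; case: ifP => h0; last by rewrite mulr0.
    by rewrite mulrA exprS invfM.
  apply/cvgr0Pnorm_lt => e e0; near=> h; apply: le_lt_trans (flat_le _ _) _.
  rewrite mulrC -ltr_pdivlMr ?ltr0n ?fact_gt0 //; near: h.
  by apply: dnbhs0_lt; rewrite divr_gt0 ?ltr0n ?fact_gt0.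
by apply: DeriveDef; [apply/cvg_ex; exists 0|apply: cvg_lim].
Unshelve. all: by end_near. Qed.

Lemma Coo_flat k (U : set R) : Coo U (flat k).
Proof.
have dflat j x : differentiable (flat j) x.
  by apply/derivable1_diffP; have [] := is_derive_flat j x.
(* [CkD] and [CkM] ask for an open set, whereas [U] is arbitrary; the whole line serves. *)
move=> n; apply: (@Ck_sub _ _ _ _ _ setT) => //.
elim: n k => [|n IHn] k /=.
  by move=> x _; exact: differentiable_continuous.
split=> // v.
have -> : 'D_v (flat k) =
    cst v * ((cst (- k%:R) * flat k.+1 : R -> R) + flat k.+2).
  apply/funext => x; rewrite -[in LHS](mulr1 v) deriveE // linearZ -deriveE //.
  by have [_ ->] := is_derive_flat k x.
apply: CkM openT (Ck_cst _ _ _) _; apply: CkD openT _ (IHn _).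
exact: CkM openT (Ck_cst _ _ _) (IHn _).
Qed.

End FlatFunction.

(** * Bump functions on the space of row vectors *)

Section Bump.
Context {R : realType} {m : nat}.

(** The product over j of [flat 0] at (e/2)^2 - (x_j - a_j)^2, scaled to 1 at [a], vanishes off the
    closed cube [K] of half-side e/2, which lies in the sup-norm ball of radius e. *)
Lemma exists_bump (U : set 'rV[R]_m) (a : 'rV[R]_m) : open U -> U a ->
  exists (rho : 'rV[R]_m -> R) (K : set 'rV[R]_m),
    [/\ compact K, K `<=` U, Coo setT rho, rho a = 1 &
        forall x, ~ K x -> rho x = 0].
Proof.
move=> oU Ua; have /nbhs_ballP[e /= e0 aeU] : nbhs a U by exact: open_nbhs_nbhs.
have e20 : 0 < e / 2 by rewrite divr_gt0.
pose x0 (j : 'I_m) : 'rV[R]_m -> R := row_coord j - cst (a 0 j).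
pose w (j : 'I_m) : 'rV[R]_m -> R := cst ((e / 2) ^+ 2) + - (x0 j * x0 j).
have wE j x : w j x = (e / 2) ^+ 2 - (x 0 j - a 0 j) ^+ 2 by [].
pose b := (flat 0 ((e / 2) ^+ 2))^-1.
pose rho x := \prod_j (b * flat 0 (w j x)).
pose I (j : 'I_m) := `[a 0 j - e / 2, a 0 j + e / 2]%classic.
pose K := [set x : 'rV[R]_m | forall j, I j (x 0 j)].
have inK x : K x <-> forall j, `|x 0 j - a 0 j| <= e / 2.
  split=> xK j; have := xK j; rewrite /I /= in_itv /= ler_distl //.
exists rho, K; split.
- by apply: (@rV_compact R m I) => j; exact: segment_compact.
- move=> x /inK xK; apply: aeU; split=> // i j; rewrite ord1 /ball /=.
  rewrite distrC (le_lt_trans (xK j)) // ltr_pdivrMr // mulr_natr mulr2n.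
  by rewrite ltrDl.
- move=> k.
  rewrite /rho -(@fct_prodE _ _ _ _ xpredT (fun j x => b * flat 0 (w j x))).
  elim/big_ind: _ => [|f g|j _]; [exact: Ck_cst|exact: CkM openT|].
  apply: (CkM openT (@Ck_cst _ _ _ k _ b)).
  apply: (@Ck_comp_R _ _ _ _ setT (flat 0) (w j)) => //.
  - exact: openT.
  2: exact: Coo_flat.
  have Cc : Ck k setT (x0 j).
    apply: (@CkD _ _ R k setT (row_coord j) (cst (- a 0 j)) openT).
      exact: Ck_row_coord.
    exact: Ck_cst.
  apply: CkD openT (Ck_cst _ _ _) _.
  apply: (@eq_Ck _ _ _ _ _ (cst (-1) * (x0 j * x0 j))) openT _ _.
    by move=> x _; rewrite !fctE mulN1r.
  exact: CkM openT (Ck_cst _ _ _) (CkM openT Cc Cc).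
- rewrite /rho big1 // => j _; rewrite wE subrr expr0n /= subr0 /b mulVf //.
  by rewrite gt_eqF // flat_gt0 // exprn_gt0.
move=> x xK; have [j] : exists j, ~ (`|x 0 j - a 0 j| <= e / 2).
  by apply/existsNP => /inK.
move/negP; rewrite -ltNge => xj.
rewrite /rho (bigD1 j) //= flat_le0 ?mulr0 ?mul0r // wE subr_le0.
rewrite -(real_normK (num_real (_ - _))).
by apply: lerXn2r; rewrite ?nnegrE // ltW.
Qed.

End Bump.

(** * Extension by zero of functions given in a chart *)

Section Extension.
Context {R : realType} {m : nat} {M : manifold R m}.
Implicit Types (c d : chart R M m).

(** This image is the part of the open chart image that the continuous [chart_inv c] sends into
    [O]. *)
Lemma open_chart_image c (O : set M) :
  open O -> open (c @` (chart_dom c `&` O)).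
Proof.
move=> oO.
have /(continuous_inP (chart_inv c)) inv_inP := chart_img_open c.
have /inv_inP/(_ O oO) : {in c @` chart_dom c, continuous (chart_inv c)}.
  by move=> x /set_mem /chart_inv_continuous.
congr open; apply/seteqP; split=> [_ [[q cq <-]] /=|_ [q [cq Oq] <-]].
  by rewrite chartK // => Oq; exists q.
by split; [exists q|rewrite /= chartK].
Qed.

Definition extend0 c (u : 'rV[R]_m -> R) (q : M) : R :=
  if `[< chart_dom c q >] then u (c q) else 0.

(** The image of [K] in [M] is compact, hence closed since [M] is Hausdorff. So two open sets cover
    [M]: the domain of [c], where [u] is composed with a transition map, and the complement of that
    image, where the extension is 0. *)
Lemma smooth_extend0 c (u : 'rV[R]_m -> R) (K : set 'rV[R]_m) :
  atlas c -> compact K -> K `<=` c @` chart_dom c ->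
  Coo (c @` chart_dom c) u ->
  (forall x, (c @` chart_dom c) x -> ~ K x -> u x = 0) -> smooth (extend0 c u).
Proof.
move=> ac cK Kc Cu uK0 d ad k.
have oK : open (~` (chart_inv c @` K)).
  apply: closed_openC; apply: (compact_closed (@carrier_hausdorff R m M)).
  apply: continuous_compact cK; apply: continuous_in_subspaceT => x /set_mem.
  by move=> /Kc /chart_inv_continuous.
apply: Ck_local => _ [q dq <-].
have [cq|ncq] := pselect (chart_dom c q).
  exists (d @` (chart_dom d `&` chart_dom c)); first by exists q.
  have oW := @open_chart_image d _ (chart_dom_open c).
  apply: (@eq_Ck _ _ _ _ _ (u \o (c \o chart_inv d))) => //.
    by move=> _ [r [dr cr] <-]; rewrite /extend0 /= chartK // asboolT.
  apply: Ck_comp_rV oW _ (atlas_compat ad ac k) (Cu k).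
  by move=> _ [r [dr cr] <-]; exists r; rewrite //= chartK.
have oW := @open_chart_image d _ oK.
exists (d @` (chart_dom d `&` ~` (chart_inv c @` K))).
  exists q => //; split=> // -[x Kx xq]; apply: ncq.
  by have [r cr rx] := Kc _ Kx; rewrite -xq -rx chartK.
apply: (@eq_Ck _ _ _ _ _ (cst 0)) (Ck_cst _ _ _) => // _ [r [dr Kr] <-].
rewrite /extend0 /= chartK //; case: asboolP => // cr; rewrite uK0 //.
by move=> Kcr; apply: Kr; exists (c r) => //; rewrite chartK.
Qed.

End Extension.

(** * Global vector fields forming a frame at a given point *)

Section LocalFrame.
Context {R : realType} {m : nat} {M : manifold R m}.
Implicit Types (c : chart R M m) (rho : 'rV[R]_m -> R) (f : smoothfun M).

Lemma chart_image_nbhs c q : chart_dom c q ->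
  nbhs (c q) (c @` chart_dom c).
Proof.
by move=> cq; apply: open_nbhs_nbhs; split; [exact: chart_img_open|exists q].
Qed.

Lemma differentiable_smoothfun c f q : atlas c -> chart_dom c q ->
  differentiable (f \o chart_inv c) (c q).
Proof.
by move=> ac cq; have [+ _] := smoothfunP f ac 1; apply; exists q.
Qed.

(** The coordinate field in direction [v], cut off by [rho], acting on [f]. *)
Definition chart_derivative c rho (v : 'rV[R]_m) (q : M) f : R :=
  extend0 c (fun x => rho x * 'D_v (f \o chart_inv c) x) q.

Lemma chart_derivative_derivation c rho v q : atlas c ->
  derivation_at q (chart_derivative c rho v q).
Proof.
move=> ac; rewrite /chart_derivative /extend0.
case: asboolP => cq; last by split=> [a f g|f g]; rewrite !mulr0 addr0.
have df f : derivable (f \o chart_inv c) (c q) v.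
  by apply: diff_derivable; exact: differentiable_smoothfun.
split=> [a f g|f g].
  have -> : (a *: f + g) \o chart_inv c =
    a *: (f \o chart_inv c) + (g \o chart_inv c) by [].
  rewrite deriveD //; last exact: derivableZ.
  by rewrite deriveZ // /GRing.scale /=; ring.
have -> : (f * g) \o chart_inv c =
  (f \o chart_inv c) * (g \o chart_inv c) by [].
by rewrite deriveM //= chartK // /GRing.scale /=; ring.
Qed.

Lemma chart_derivative_smooth c rho v (K : set 'rV[R]_m) f : atlas c ->
  compact K -> K `<=` c @` chart_dom c -> Coo setT rho ->
  (forall x, ~ K x -> rho x = 0) ->
  smooth (fun q => chart_derivative c rho v q f).
Proof.
move=> ac cK Kc Crho rhoK; apply: (smooth_extend0 ac cK Kc) => [k|x _ Kx].
  apply: CkM; [exact: chart_img_open|exact: (Ck_sub _ (Crho k))|].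
  by have [_ +] := smoothfunP f ac k.+1; apply.
by rewrite rhoK // mul0r.
Qed.

Lemma exists_local_frame (p : M) :
  exists (E : 'I_m -> vfield M) (x : 'I_m -> smoothfun M),
    forall i j, E i p (x j) = (i == j)%:R.
Proof.
have [c ac cp] := atlas_cover p.
have cpc : (c @` chart_dom c) (c p) by exists p.
have [rho [K [cK Kc Crho rhop rhoK]]] := exists_bump (chart_img_open c) cpc.
pose E i := VField (fun f : smoothfun M =>
  chart_derivative_smooth 'e_i f ac cK Kc Crho rhoK
  : smooth (fun q => tangent_of (chart_derivative_derivation rho 'e_i q ac) f)).
(* The coordinates centred at [p], cut off so that they extend to [M]. *)
pose u j : 'rV[R]_m -> R := rho * (row_coord j - cst (c p 0 j)).
have Cu j : Coo setT (u j).
  move=> k; apply: CkM openT (Crho k) _.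
  apply: (@CkD _ _ R k setT (row_coord j) (cst (- c p 0 j)) openT).
    exact: Ck_row_coord.
  exact: Ck_cst.
have su j : smooth (extend0 c (u j) : M -> R).
  apply: (smooth_extend0 ac cK Kc) => [k|x _ Kx].
    exact: Ck_sub (Cu j k).
  by rewrite /u fctE rhoK // mul0r.
exists E, (fun j => smoothfun_of (su j)) => i j.
rewrite /= /chart_derivative {1}/extend0 asboolT // rhop mul1r.
have -> : 'D_('e_i) (extend0 c (u j) \o chart_inv c) (c p) =
    'D_('e_i) (u j) (c p).
  apply: derive_near_eq; apply: filterS (chart_image_nbhs cp) => _ [q cq <-].
  by rewrite /= chartK // /extend0 asboolT.
have drho : derivable rho (c p) 'e_i.
  by apply: diff_derivable; have [+ _] := Crho 1; apply.
have cj : continuous (@row_coord R m j) by exact: coord_continuous.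
have dj : differentiable (@row_coord R m j) (c p).
  exact: linear_differentiable.
have dw : derivable (row_coord j - cst (c p 0 j) : 'rV[R]_m -> R) (c p) 'e_i.
  by apply: diff_derivable; apply: differentiableB.
(* The centred coordinate is 0 at [c p], so the derivative of [rho] drops out. *)
rewrite /u deriveM // deriveB ?derive_cst //; last exact: diff_derivable.
rewrite deriveE // diff_lin // rhop !fctE subrr scale0r addr0 subr0 scale1r.
by rewrite /= /row_coord mxE eqxx eq_sym.
Qed.

End LocalFrame.

(** * Nondegeneracy of the metric on vector fields *)

Section Nondegenerate.
Context {R : realType}.

(** Pairing [w] with [e i] reads off its i-th coordinate up to sign. *)
Lemma signature_nondegenerate (V : lmodType R) (b : {biscalar V}) r s (w : V) :
  has_signature b r s -> (forall v, b w v = 0) -> w = 0.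
Proof.
move=> [e [eV be]] bw; have [a [wa _]] := eV w.
have a0 i : a 0 i = 0.
  have := bw (e i); rewrite wa linear_sumlz (bigD1 i) //= linearZl_LR /=.
  rewrite be eqxx big1 ?addr0 => [|j ji]; last first.
    by rewrite linearZl_LR /= be (negbTE ji) mulr0.
  by case: ifP => _ /eqP; rewrite ?mulrN ?mulr1 ?oppr_eq0 => /eqP.
by rewrite wa big1 // => i _; rewrite a0 scale0r.
Qed.

(* [E] is linearly independent because of the dual family [x], hence a basis by
   dimension. *)
Lemma dual_family_spans (V : lmodType R) (n : nat) (e : 'I_n -> V)
    (E : 'I_n -> V) (x : 'I_n -> V -> R) :
  (forall v, exists a : 'rV[R]_n, v = \sum_i a 0 i *: e i) ->
  (forall j a v w, x j (a *: v + w) = a * x j v + x j w) ->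
  (forall i j, x j (E i) = (i == j)%:R) ->
  forall v, exists a : 'rV[R]_n, v = \sum_i a 0 i *: E i.
Proof.
move=> eV xl xE.
have xlin j : linear (x j : V -> R^o) by move=> a u v; exact: xl.
have xsum j (a : 'I_n -> R) (u : 'I_n -> V) :
    x j (\sum_i a i *: u i) = \sum_i a i * x j (u i).
  pose X : {linear V -> R^o} :=
    HB.pack (x j) (GRing.isLinear.Build R V R^o _ (x j) (xlin j)).
  have -> : x j = X by [].
  by rewrite linear_sum; apply: eq_bigr => i _; rewrite linearZ.
have [A eE] := choice (fun i => eV (E i)).
pose B := \matrix_(i, j) A i 0 j.
pose C := \matrix_(i, j) x j (e i).
(* [B] expresses [E] through [e]. As the matrices are square, [C *m B = 1] follows, so [C] expresses
   [e] through [E]. *)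
have BC : B *m C = 1%:M.
  apply/matrixP => i j; rewrite !mxE -xE {1}(eE i) xsum.
  by apply: eq_bigr => k _; rewrite !mxE.
have CB := mulmx1C BC => v; have [a ->] := eV v.
exists (a *m C); under [RHS]eq_bigr => i _ do rewrite (eE i) scaler_sumr.
rewrite exchange_big /=; apply: eq_bigr => j _.
under [RHS]eq_bigr => i _ do rewrite scalerA.
rewrite -scaler_suml; congr (_ *: _); rewrite -{1}[a]mulmx1 -CB mulmxA !mxE.
by apply: eq_bigr => i _; rewrite !mxE.
Qed.

(** The frame fields at [p] span the tangent space, so orthogonality to all vector fields gives
    orthogonality to all tangent vectors at [p]. *)
Lemma metric_nondegenerate (m : nat) (M : manifold R m) (r s : nat)
    (g : pseudo_metric M r s) (W : vfield M) :
  (r + s)%N = m -> (forall Z, g W Z = 0) -> W = 0.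
Proof.
move=> rsm gW0; apply: vfield_eq => p.
have sg := metric_signature g p.
apply: signature_nondegenerate (sg) _ => v.
have [E [x Ex]] := exists_local_frame p.
have [e [eV _]] := sg; rewrite rsm in e eV.
have [|j a u w|i j|a ->] := @dual_family_spans _ _ e (fun i => E i p)
  (fun j (u : tangent p) => u (x j)) _ _ _ v.
- by move=> u; have [a [ua _]] := eV u; exists a.
- by [].
- exact: Ex.
rewrite linear_sumr big1 // => i _; rewrite linearZr_LR /=.
have /(congr1 (fun f : smoothfun M => f p)) /= -> := gW0 (E i).
by rewrite mulr0.
Qed.

End Nondegenerate.

(** * Linearity rules for tensor fields and connections *)

Section FieldLinearity.
Context {R : realType} {m : nat} {M : manifold R m}.
Implicit Types (x y z : vfield M) (f : smoothfun M).

(** Together with [smoothfun_evalE], these rules turn identities between fields into identities in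
    [R], within reach of [ring] and [lra]. *)
Lemma vf_evalE :
  (forall x y p h, (x + y) p h = x p h + y p h) *
  (forall x p h, (- x) p h = - x p h) *
  (forall f x p h, (f *: x) p h = f p * x p h) *
  (forall p h, (0 : vfield M) p h = 0).
Proof. by []. Qed.

Lemma smoothfun_evalE :
  (forall f h p, (f + h) p = f p + h p) * (forall f p, (- f) p = - f p) *
  (forall f h p, (f * h) p = f p * h p) *
  (forall p, (0 : smoothfun M) p = 0) * (forall p, (1 : smoothfun M) p = 1).
Proof. by []. Qed.

(** Division by 2, carried out at each point. *)
Lemma smoothfun_double_eq0 f : f + f = 0 -> f = 0.
Proof.
move=> f0; apply: smoothfun_eq => p.
have : f p + f p = 0 by rewrite -[LHS]/((f + f) p) f0.
by move=> {f0} f0; rewrite smoothfun_evalE; lra.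
Qed.

Lemma vfield_ext x y : (forall p h, x p h = y p h) -> x = y.
Proof. by move=> xy; apply: vfield_eq => p; exact: tangent_eq. Qed.

Lemma endo_appD (phi : endofield M) x y : phi (x + y) = phi x + phi y.
Proof. by apply: vfield_eq => p /=; rewrite linearD. Qed.

Lemma endo_appZ (phi : endofield M) f x : phi (f *: x) = f *: phi x.
Proof. by apply: vfield_eq => p /=; rewrite linearZ. Qed.

Lemma endo_appN (phi : endofield M) x : phi (- x) = - phi x.
Proof. by apply: vfield_eq => p /=; rewrite linearN. Qed.

Lemma form_appD (eta : oneform M) x y : eta (x + y) = eta x + eta y.
Proof. by apply: smoothfun_eq => p /=; rewrite linearD. Qed.

Lemma form_appZ (eta : oneform M) f x : eta (f *: x) = f * eta x.
Proof. by apply: smoothfun_eq => p /=; rewrite linearZ. Qed.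

Lemma form_appN (eta : oneform M) x : eta (- x) = - eta x.
Proof. by apply: smoothfun_eq => p /=; rewrite linearN. Qed.

Section Metric.
Variables (r s : nat) (g : pseudo_metric M r s).

Lemma metric_appC x y : g x y = g y x.
Proof. by apply: smoothfun_eq => p /=; rewrite Defs.metric_sym. Qed.

Lemma metric_appDr x y z : g x (y + z) = g x y + g x z.
Proof. by apply: smoothfun_eq => p /=; rewrite linearDr. Qed.

Lemma metric_appZr f x y : g x (f *: y) = f * g x y.
Proof. by apply: smoothfun_eq => p /=; rewrite linearZr_LR. Qed.

Lemma metric_appNr x y : g x (- y) = - g x y.
Proof. by apply: smoothfun_eq => p /=; rewrite linearNr. Qed.

Lemma metric_appDl x y z : g (x + y) z = g x z + g y z.
Proof. by rewrite metric_appC metric_appDr !(metric_appC z). Qed.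

Lemma metric_appZl f x y : g (f *: x) y = f * g x y.
Proof. by rewrite metric_appC metric_appZr metric_appC. Qed.

Lemma metric_appNl x y : g (- x) y = - g x y.
Proof. by rewrite metric_appC metric_appNr metric_appC. Qed.

End Metric.

Section Connection.
Variables (nabla : vfield M -> vfield M -> vfield M).
Hypothesis nabla_aff : affine_connection nabla.

Lemma connectionDl x y z : nabla (x + y) z = nabla x z + nabla y z.
Proof.
by case: nabla_aff => /(_ 1 x y z) + _ _; rewrite !scale1r.
Qed.

Lemma connection0l z : nabla 0 z = 0.
Proof. by apply: (addrI (nabla 0 z)); rewrite -connectionDl !addr0. Qed.

Lemma connectionNl x z : nabla (- x) z = - nabla x z.
Proof.
by apply: (addrI (nabla x z)); rewrite -connectionDl !subrr connection0l.
Qed.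

Lemma connectionZl f x z : nabla (f *: x) z = f *: nabla x z.
Proof.
by case: nabla_aff => /(_ f x 0 z) + _ _; rewrite connection0l !addr0.
Qed.

Lemma connectionDr x y z : nabla x (y + z) = nabla x y + nabla x z.
Proof. by case: nabla_aff. Qed.

Lemma connection0r x : nabla x 0 = 0.
Proof. by apply: (addrI (nabla x 0)); rewrite -connectionDr !addr0. Qed.

Lemma connectionNr x z : nabla x (- z) = - nabla x z.
Proof.
by apply: (addrI (nabla x z)); rewrite -connectionDr !subrr connection0r.
Qed.

Lemma connectionZr f x z : nabla x (f *: z) = vf_app x f *: z + f *: nabla x z.
Proof. by case: nabla_aff. Qed.

End Connection.

End FieldLinearity.

(** * First identities of the almost contact complex Riemannian structure *)

Section AccRGeometry.
Context {R : realType} {n : nat} {M : manifold R (2 * n + 1)%N}.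
Variables (S : accR_structure M) (nabla : vfield M -> vfield M -> vfield M).
Hypothesis nabla_lc : levi_civita (acc_g S) nabla.
Local Notation phi := (acc_phi S).
Local Notation xi := (acc_xi S).
Local Notation eta := (acc_eta S).
Local Notation g := (acc_g S).
Local Notation A := (nabla_phi S nabla).
Implicit Types (x y z : vfield M).

Let linE := (endo_appD phi, endo_appZ phi, endo_appN phi, form_appD eta,
  form_appZ eta, form_appN eta, metric_appDl g, metric_appDr g,
  metric_appZl g, metric_appZr g, metric_appNl g, metric_appNr g).

Let naff : affine_connection nabla. Proof. by case: nabla_lc. Qed.

Let connE := (connectionDl naff, connectionNl naff, connectionZl naff,
  connectionDr naff, connectionNr naff, connectionZr naff).

Lemma lie_nabla x y : lie x y = nabla x y - nabla y x.
Proof. by case: nabla_lc. Qed.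

Lemma app_metric x y z : vf_app x (g y z) = g (nabla x y) z + g y (nabla x z).
Proof. by case: nabla_lc. Qed.

(** Compatibility with first argument [xi], where [phi xi = 0]. *)
Lemma metric_xil y : g xi y = eta y.
Proof.
have := acc_compat S xi y; rewrite acc_phi_xi acc_eta_xi mul1r => E.
apply/esym/(addrI (- g xi y)); rewrite -E addNr.
by rewrite -(scale0r xi) metric_appZl mul0r.
Qed.

Lemma metric_xir y : g y xi = eta y.
Proof. by rewrite metric_appC metric_xil. Qed.

(** Compatibility at [phi x] and [y], with [phi (phi x)] expanded and [eta (phi y) = 0]. *)
Lemma metric_phiC x y : g (phi x) y = g x (phi y).
Proof.
have := acc_compat S (phi x) y.
rewrite acc_phi2 acc_eta_phi mul0r addr0 !linE metric_xil acc_eta_phi mulr0.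
rewrite addr0.
by move=> /oppr_inj ->.
Qed.

Lemma metric_phi2 x y : g x (phi (phi y)) = - g x y + eta x * eta y.
Proof. by rewrite -metric_phiC acc_compat. Qed.

(** The form k of the overview; by [app_eta] it is the covariant derivative of [eta]. *)
Definition dxi x y : smoothfun M := g (nabla x xi) y.

Lemma app_eta x y : vf_app x (eta y) = eta (nabla x y) + dxi x y.
Proof. by rewrite -metric_xil app_metric metric_xil addrC. Qed.

(** Differentiating g(xi,xi) = 1 gives twice this function; [x] kills 1 by the Leibniz rule on 1 *
    1. *)
Lemma eta_nabla_xi x : eta (nabla x xi) = 0.
Proof.
apply: smoothfun_double_eq0; rewrite -{1}metric_xir -metric_xil -app_metric.
rewrite metric_xil acc_eta_xi; apply: smoothfun_eq => p.
have := vf_appM x 1 1; rewrite !mul1r => /(congr1 (fun h : smoothfun M => h p)).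
rewrite !smoothfun_evalE => {}E; lra.
Qed.

(** [phi] is symmetric for [g] and [g] is parallel, so the covariant derivative of [phi] is
    symmetric too. *)
Lemma F_tensorC x y z : F_tensor S nabla x y z = F_tensor S nabla x z y.
Proof.
have E u v w : g (nabla u v) w = vf_app u (g v w) - g v (nabla u w).
  by rewrite app_metric addrK.
rewrite /F_tensor /nabla_phi !linE !E !metric_phiC (metric_appC g z).
rewrite metric_phiC (metric_appC g (nabla x y)) metric_phiC.
rewrite (metric_appC g (nabla x z)) metric_phiC; ring.
Qed.

(** The covariant derivative of the identity for [phi] squared. *)
Lemma nabla_phi_phi x y :
  A x (phi y) = dxi x y *: xi + eta y *: nabla x xi - phi (A x y).
Proof.
rewrite /nabla_phi acc_phi2 !connE !linE acc_phi2 app_eta.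
apply: vfield_ext => p h; rewrite !(vf_evalE, smoothfun_evalE); ring.
Qed.

Lemma nabla_phi_xi x : A x xi = - phi (nabla x xi).
Proof. by rewrite /nabla_phi acc_phi_xi connection0r // sub0r. Qed.

Lemma phi_nabla_phi_xi x : phi (A x xi) = nabla x xi.
Proof.
by rewrite nabla_phi_xi linE acc_phi2 eta_nabla_xi scale0r addr0 opprK.
Qed.

Lemma nabla_phiDl x y z : A (x + y) z = A x z + A y z.
Proof.
rewrite /nabla_phi !connE !linE.
by apply: vfield_ext => p h; rewrite !vf_evalE; ring.
Qed.

Lemma nabla_phiZl f x z : A (f *: x) z = f *: A x z.
Proof. by rewrite /nabla_phi !connE !linE scalerBr. Qed.

Lemma nabla_phiDr x y z : A x (y + z) = A x y + A x z.
Proof.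
rewrite /nabla_phi !(linE, connE).
by apply: vfield_ext => p h; rewrite !vf_evalE; ring.
Qed.

(** The two terms in the derivative of [f] cancel. *)
Lemma nabla_phiZr f x z : A x (f *: z) = f *: A x z.
Proof.
rewrite /nabla_phi !(linE, connE).
by apply: vfield_ext => p h; rewrite !(vf_evalE, smoothfun_evalE); ring.
Qed.

(** The tensor B of the overview. *)
Definition half_nijenhuis x y : vfield M :=
  A (phi x) y - phi (A x y) + dxi x y *: xi.

(** Without torsion, brackets become covariant derivatives and the differential of [eta] becomes
    [dxi x y - dxi y x]. *)
Lemma nijenhuisE x y :
  nijenhuis S x y = half_nijenhuis x y - half_nijenhuis y x.
Proof.
rewrite /nijenhuis /nijenhuis_phi /half_nijenhuis /d_form /nabla_phi.
rewrite !lie_nabla !app_eta !linE.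
by apply: vfield_ext => p h; rewrite !(vf_evalE, smoothfun_evalE); ring.
Qed.

(** Since [g] is parallel and torsion vanishes, the Lie derivative of [g] along [xi] is
    [dxi x y + dxi y x]. *)
Lemma assoc_nijenhuisE x y :
  assoc_nijenhuis S nabla x y = half_nijenhuis x y + half_nijenhuis y x.
Proof.
rewrite /assoc_nijenhuis /assoc_nijenhuis_phi /half_nijenhuis /lie_metric.
rewrite /sym_bracket /nabla_phi !lie_nabla app_metric !linE /dxi.
rewrite (metric_appC g x (nabla y xi)) (metric_appC g x (nabla xi y)).
by apply: vfield_ext => p h; rewrite !(vf_evalE, smoothfun_evalE); ring.
Qed.

(** * The Sasaki-like condition and the formula for the derivative of [phi] *)

Lemma F_tensor_xi2 x : F_tensor S nabla x xi xi = 0.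
Proof.
by rewrite /F_tensor metric_xir nabla_phi_xi linE acc_eta_phi oppr0.
Qed.

Definition sasaki_formula x y : vfield M :=
  - (g x y *: xi) - eta y *: x + (2%:R * eta x * eta y) *: xi.

Lemma sasaki_formula_of_F :
  (forall x y z, F_tensor S nabla x y z = g (sasaki_formula x y) z) ->
  forall x y, A x y = sasaki_formula x y.
Proof.
move=> FE x y; apply/eqP; rewrite -subr_eq0; apply/eqP.
apply: (metric_nondegenerate (g := g)) => [|z].
  by rewrite mul2n -addnn addn1.
by rewrite metric_appDl metric_appNl -FE subrr.
Qed.

Lemma metric_sasaki_formula x y z : g (sasaki_formula x y) z =
  - (g x y * eta z) - eta y * g x z + 2%:R * eta x * eta y * eta z.
Proof. by rewrite /sasaki_formula !linE metric_xil. Qed.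

Lemma sasaki_like_formula :
  sasaki_like S nabla -> forall x y, A x y = sasaki_formula x y.
Proof.
move=> SL; apply: sasaki_formula_of_F => x y z.
(* Of the eight components of F only F(X,Y,xi) and F(X,xi,Z) survive. *)
have FX X Y Z a b c : eta X = 0 -> eta Y = 0 -> eta Z = 0 ->
    F_tensor S nabla (X + a *: xi) (Y + b *: xi) (Z + c *: xi) =
    - (g X Y * c) - g X Z * b.
  move=> X0 Y0 Z0; have [XYZ YZ xiZ XY] := SL X Y Z X0 Y0 Z0.
  (* With [Y] and [Z] exchanged, symmetry yields F(X,xi,Z) and F(xi,Y,xi); [F_tensor_xi2] covers the
     components ending in xi, xi. *)
  have [_ _ xiY XZ] := SL X Z Y X0 Z0 Y0.
  have := F_tensor_xi2 X; have := F_tensor_xi2 xi.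
  rewrite (F_tensorC X Z xi) in XZ; rewrite (F_tensorC xi xi Y) in xiY.
  move: XYZ YZ xiZ XY XZ xiY.
  rewrite /F_tensor !(nabla_phiDl, nabla_phiZl, nabla_phiDr, nabla_phiZr).
  (* Abstracted, lest [linE] rewrite inside the unfolded [nabla_phi]. *)
  move: (nabla_phi S nabla) => B; rewrite !linE.
  by move=> -> -> -> -> -> -> -> ->; ring.
pose H v := v - eta v *: xi.
have H0 v : eta (H v) = 0 by rewrite /H !linE acc_eta_xi mulr1 subrr.
have HE v : v = H v + eta v *: xi by rewrite subrK.
rewrite metric_sasaki_formula {1}(HE x) {1}(HE y) {1}(HE z) FX //.
rewrite /H !linE !metric_xil !metric_xir acc_eta_xi; ring.
Qed.

Lemma formula_sasaki_like :
  (forall x y, A x y = sasaki_formula x y) -> sasaki_like S nabla.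
Proof.
move=> AE X Y Z X0 Y0 Z0; rewrite /F_tensor !AE !metric_sasaki_formula.
rewrite X0 Y0 Z0 acc_eta_xi !metric_xil Z0; split; ring.
Qed.

(** * The formula for the derivative of [phi] and the tensor B *)

Lemma formula_half_nijenhuis : (forall x y, A x y = sasaki_formula x y) ->
  forall x y, half_nijenhuis x y = (- 2%:R * g x (phi y)) *: xi.
Proof.
move=> AE x y.
(* The formula at y = xi reads [A x xi = - x + eta x *: xi]; now apply [phi]. *)
have dE : nabla x xi = - phi x.
  rewrite -phi_nabla_phi_xi AE /sasaki_formula !linE acc_phi_xi acc_eta_xi.
  by rewrite !scaler0 scale1r oppr0 add0r addr0.
rewrite /half_nijenhuis /dxi dE !AE /sasaki_formula !linE acc_phi_xi.
rewrite acc_eta_phi metric_phiC.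
by apply: vfield_ext => p h; rewrite !(vf_evalE, smoothfun_evalE); ring.
Qed.

Lemma half_nijenhuis_formula :
  (forall x y, half_nijenhuis x y = (- 2%:R * g x (phi y)) *: xi) ->
  forall x y, A x y = sasaki_formula x y.
Proof.
move=> BE.
have Fphil x y z : F_tensor S nabla (phi x) y z = F_tensor S nabla x y (phi z)
    - (dxi x y + 2%:R * g x (phi y)) * eta z.
  have := congr1 (g^~ z) (BE x y); rewrite /half_nijenhuis /F_tensor.
  move: (nabla_phi S nabla) => B; rewrite !linE metric_phiC metric_xil => E.
  have -> : g (B (phi x) y) z = - 2%:R * g x (phi y) * eta z
     + g (B x y) (phi z) - dxi x y * eta z by rewrite -E; ring.
  ring.
have Fphir x y z : F_tensor S nabla x y (phi z) =
    (dxi x y + g x (phi y)) * eta z - g x (phi z) * eta y.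
  have E1 : F_tensor S nabla x z (phi y) = dxi x y * eta z + eta y * dxi x z
      - F_tensor S nabla x y (phi z).
    rewrite F_tensorC /F_tensor nabla_phi_phi.
    by move: (nabla_phi S nabla) => B; rewrite !linE metric_xil metric_phiC.
  (* [E1] gives the sum of F(x,y,phi z) and F(x,z,phi y), and [E2] with [Fphil] gives their
     difference; adding them doubles F(x,y,phi z), and [dxi x z] cancels. *)
  have E2 := F_tensorC (phi x) y z.
  rewrite !Fphil E1 in E2.
  apply/eqP; rewrite -subr_eq0; apply/eqP; apply: smoothfun_double_eq0.
  move/eqP: E2; rewrite -subr_eq0 => /eqP <-; ring.
(* At z = xi every term of [Fphir] containing [phi z] vanishes. *)
have dxiE x y : dxi x y = - g x (phi y).
  have := Fphir x y xi; rewrite acc_phi_xi acc_eta_xi mulr1.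
  have g0 u : g u 0 = 0 by rewrite -(scale0r xi) metric_appZr mul0r.
  rewrite /F_tensor !g0 mul0r subr0 => /esym/eqP.
  by rewrite addr_eq0 => /eqP.
apply: sasaki_formula_of_F => x y z; rewrite metric_sasaki_formula.
have Fxi : F_tensor S nabla x y xi = - g x y + eta x * eta y.
  rewrite F_tensorC /F_tensor nabla_phi_xi linE metric_phiC -[g _ _]/(dxi _ _).
  by rewrite dxiE metric_phi2 opprK.
(* [Fphir] reaches only last arguments in the image of [phi]; [Fxi] supplies the rest. *)
have zE : z = - phi (phi z) + eta z *: xi by rewrite acc_phi2 opprD opprK subrK.
have -> : F_tensor S nabla x y z = - F_tensor S nabla x y (phi (phi z))
    + eta z * F_tensor S nabla x y xi.
  by rewrite {1}zE /F_tensor metric_appDr metric_appNr metric_appZr.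
rewrite Fxi Fphir acc_eta_phi metric_phi2; ring.
Qed.

End AccRGeometry.

Theorem theorem3p3 (R : realType) (n : nat) (M : manifold R (2 * n + 1)%N)
    (S : accR_structure M) (nabla : vfield M -> vfield M -> vfield M)
    (nabla_lc : levi_civita (acc_g S) nabla) :
  let xi := acc_xi S in
  let eta := acc_eta S in
  let g := acc_g S in
  let cond_a := sasaki_like S nabla in
  let cond_b := forall x y : vfield M,
    nabla_phi S nabla x y =
      - (g x y *: xi) - eta y *: x + (2%:R * eta x * eta y) *: xi in
  let cond_c :=
    (forall x y : vfield M, nijenhuis S x y = 0) /\
    (forall x y : vfield M, assoc_nijenhuis S nabla x y =
       (- 4%:R * (assoc_metric S x y - eta x * eta y)) *: xi) in
  (cond_a <-> cond_b) /\ (cond_b <-> cond_c).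
Proof.
split; split.
- exact: sasaki_like_formula.
- exact: formula_sasaki_like.
- move=> /(formula_half_nijenhuis nabla_lc) BE; split=> x y.
    (* g(x, phi y) is symmetric, so the skew part of B vanishes. *)
    by rewrite (nijenhuisE nabla_lc) !BE -metric_phiC metric_appC subrr.
  rewrite (assoc_nijenhuisE nabla_lc) !BE -(metric_phiC S y).
  rewrite (metric_appC _ (acc_phi S y)) -scalerDl /assoc_metric.
  by congr (_ *: _); ring.
(* N = 0 makes B symmetric, so the associated tensor is 2B and can be halved pointwise. *)
move=> [N0 NE]; apply: (half_nijenhuis_formula nabla_lc) => x y.
have := NE x y; have := N0 x y.
rewrite (nijenhuisE nabla_lc) (assoc_nijenhuisE nabla_lc) => /subr0_eq <-.
rewrite /assoc_metric => E; apply: vfield_ext => p h.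
have := congr1 (fun v : vfield M => v p h) E.
by rewrite !(vf_evalE, smoothfun_evalE) => {}E; lra.
Qed.
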